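(* Let $V$ be a countably infinite set, let $k:V\times V\to\mathbb{R}$ be positive definite, let $\mathscr{H}=\mathscr{H}(k)$ be the corresponding reproducing kernel Hilbert space of functions on $V$, and fix $x_1\in V$. Then the following three conditions are equivalent: (i) $\delta_{x_1}\in\mathscr{H}$; (ii) there exists $C_{x_1}<\infty$ such that for all finite subsets $F\subset V$ (with $x_1\in F$) and all functions $\xi:F\to\mathbb{C}$, $$|\xi(x_1)|^2\le C_{x_1}\sum_{x\in F}\sum_{y\in F}\overline{\xi(x)}\,\xi(y)\,k(x,y);$$ (iii) with $K_F=(k(x,y))_{(x,y)\in F\times F}$, $$\sup_{F}\ \left(K_F^{-1}\delta_{x_1}\right)(x_1)<\infty,$$ where the supremum is over all finite subsets $F\subset V$ containing $x_1$.
   Context: A function $k:V\times V\to\mathbb{C}$ is positive definite if $\sum_{x\in F}\sum_{y\in F}k(x,y)\overline{c_x}c_y\ge 0$ for every finite $F\subset V$ and all $(c_x)_{x\in F}\subset\mathbb{C}$. Set $k_x=k(\cdot,x)$. $\mathscr{H}(k)$ is the Hilbert space of complex functions on $V$ obtained by completing $\mathrm{span}\{k_x:x\in V\}$ with respect to $\langle\sum c_xk_x,\sum d_yk_y\rangle_{\mathscr{H}}=\sum\sum\overline{c_x}d_yk(x,y)$ (modulo vectors of zero norm); inner products are conjugate linear in the first variable, and $\langle k_x,\varphi\rangle_{\mathscr{H}}=\varphi(x)$ for all $\varphi\in\mathscr{H}$, $x\in V$. $\delta_{x_1}:V\to\mathbb{C}$ is the function equal to $1$ at $x_1$ and $0$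 elsewhere. The matrix $K_F$ acts on functions on $F$ by $(K_F\varphi)(x)=\sum_{y\in F}k(x,y)\varphi(y)$. $K_F^{-1}\delta_{x_1}$ denotes a function $\zeta$ on $F$ solving $K_F\zeta=\delta_{x_1}|_F$. If $K_F$ is not invertible, condition (iii) includes the requirement that such a solution exists for every finite $F\ni x_1$; the value $\zeta(x_1)$ does not depend on the choice of solution. *)

(* Defs.v *)
From HB Require Import structures.
From mathcomp Require Import all_boot all_order all_algebra finmap complex.
From mathcomp Require Import all_classical all_reals all_analysis.
Set Implicit Arguments.
Unset Strict Implicit.
Unset Printing Implicit Defensive.
Import Order.TTheory GRing.Theory Num.Theory numFieldNormedType.Exports.
Local Open Scope classical_set_scope.
Local Open Scope ring_scope.
Local Open Scope complex_scope.

(* In R[i], [0 <= z] means that z is real and nonnegative. *)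
Definition positive_definite (R : realType) (V : choiceType)
    (k : V -> V -> R[i]) : Prop :=
  forall (F : {fset V}) (c : F -> R[i]),
    0 <= \sum_(x : F) \sum_(y : F) k (val x) (val y) * (c x)^* * c y.

(* A finitely supported c : V -> R[i] stands for the vector
   \sum_x c_x k_x of span {k_x : x \in V}, with k_x = k(., x). *)
Definition kcomb (R : realType) (V : choiceType) (k : V -> V -> R[i])
    (c : {fsfun V -> R[i] with 0}) : V -> R[i] :=
  fun x => \sum_(y <- finsupp c) c y * k x y.

Definition kdot (R : realType) (V : choiceType) (k : V -> V -> R[i])
    (c d : {fsfun V -> R[i] with 0}) : R[i] :=
  \sum_(x <- finsupp c) \sum_(y <- finsupp d) (c x)^* * d y * k x y.

Definition knorm (R : realType) (V : choiceType) (k : V -> V -> R[i])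
    (c : {fsfun V -> R[i] with 0}) : R :=
  Num.sqrt (complex.Re (kdot k c c)).

Definition fsfun_sub (R : realType) (V : choiceType)
    (c d : {fsfun V -> R[i] with 0}) : {fsfun V -> R[i] with 0} :=
  [fsfun x in (finsupp c `|` finsupp d)%fset => c x - d x].

Definition kcauchy (R : realType) (V : choiceType) (k : V -> V -> R[i])
    (u : nat -> {fsfun V -> R[i] with 0}) : Prop :=
  forall e : R, 0 < e ->
    \forall m & n \near \oo, knorm k (fsfun_sub (u m) (u n)) < e.

(* The underlying set of functions of H(k). A point of the completion of
   span {k_x} is the class of a Cauchy sequence (u_n); as k_x pairs with it to
   lim_n <k_x, u_n> = lim_n u_n(x), the reproducing property forces this point
   to be the function x |-> lim_n u_n(x). The norm topology is carried by R[i]^o. *)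
Definition rkhs (R : realType) (V : choiceType) (k : V -> V -> R[i])
    : set (V -> R[i]) :=
  [set f : V -> R[i] | exists2 u : nat -> {fsfun V -> R[i] with 0},
     kcauchy k u & forall x, kcomb k (u n) x @[n --> \oo] --> (f x : R[i]^o)].

Definition delta (R : realType) (V : choiceType) (x1 : V) : V -> R[i] :=
  fun x => if x == x1 then 1 else 0.

Definition kmat (R : realType) (V : choiceType) (k : V -> V -> R)
    (F : {fset V}) (phi : F -> R) : F -> R :=
  fun x => \sum_(y : F) k (val x) (val y) * phi y.

(* zeta is a K_F^-1 delta_{x1}; K_F need not be invertible. *)
Definition kmat_solution (R : realType) (V : choiceType) (k : V -> V -> R)
    (F : {fset V}) (x1 : V) (zeta : F -> R) : Prop :=
  forall x : F, kmat k zeta x = if val x == x1 then 1 else 0.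

(* Main.v *)
Require Import Defs.
From HB Require Import structures.
From mathcomp Require Import all_boot all_order all_algebra finmap complex.
From mathcomp Require Import all_classical all_reals all_analysis.
From mathcomp Require Import ring lra.

(** Pairing with k_x evaluates at x, so <xi, delta_{x1}> is the conjugate of
    xi(x1) for every finitely supported xi. All three conditions say that the
    functional xi |-> xi(x1) is bounded for the norm of H(k).

    (i) => (ii). Let (u_n) be a Cauchy sequence of finite combinations that
    represents delta_{x1}. Its norms are eventually bounded, by the
    parallelogram law, and Cauchy-Schwarz bounds |<xi, u_n>|^2 by a constant
    times the Gram form of xi. As <xi, u_n> is a finite combination of the
    values of u_n, it tends to conj xi(x1) ([rkhs_pairing_bound]).

    (ii) => (iii). If K_F^T w = 0, then the quadratic form vanishes at w, hence
    w(x1) = 0 by (ii). So delta_{x1} is orthogonal to the kernel of K_F^T and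
    lies in the range of K_F ([ex_solution_col]). A solution zeta has Gram form
    zeta^T K_F zeta = zeta(x1), so (ii) reads zeta(x1)^2 <= C zeta(x1).

    (iii) => (i). Exhaust V by increasing finite sets F_n containing x1, and let
    u_n be the combination with coefficients zeta_n = K_{F_n}^-1 delta_{x1}.
    Then u_n agrees with delta_{x1} on F_n, so <f, u_n> = conj f(x1) for every
    f supported in F_n. Hence, for m <= n,
    ||u_m - u_n||^2 = zeta_n(x1) - zeta_m(x1). The real sequence zeta_n(x1) is
    therefore nondecreasing. It is bounded by (iii), so (u_n) is Cauchy, and its
    pointwise limit is delta_{x1} ([rkhs_delta_of_solutions]). *)

Set Implicit Arguments.
Unset Strict Implicit.
Unset Printing Implicit Defensive.
Import Order.TTheory GRing.Theory Num.Theory numFieldNormedType.Exports.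
Local Open Scope classical_set_scope.
Local Open Scope ring_scope.
Local Open Scope complex_scope.

(** * The Gram form on functions *)

(** The scope is explicit because x^* alone denotes [conjc] in complex_scope,
    while inside a product it is read in ring_scope as [Num.conj]. *)
Lemma ge0_conj (R : realType) (x : R[i]) : 0 <= x -> (x^*)%R = x.
Proof. by move=> /ger0_real/CrealP. Qed.

(** The sesquilinear form <f, g> = sum_{x, y in A} conj(f x) g(y) kappa(x, y),
    for arbitrary functions f and g on V, of which only the values on A matter:
    functions can be added and scaled without tracking supports. *)
Definition gram (R : realType) (V : choiceType) (kappa : V -> V -> R[i])
    (A : seq V) (f g : V -> R[i]) : R[i] :=
  \sum_(x <- A) \sum_(y <- A) (f x)^* * g y * kappa x y.

Lemma eq_gram (R : realType) (V : choiceType) (kappa : V -> V -> R[i])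
    (A : seq V) (f f' g g' : V -> R[i]) :
  {in A, f =1 f'} -> {in A, g =1 g'} -> gram kappa A f g = gram kappa A f' g'.
Proof.
move=> ff gg; apply: eq_big_seq => x xA; apply: eq_big_seq => y yA.
by rewrite ff ?gg.
Qed.

Lemma gramDZ (R : realType) (V : choiceType) (kappa : V -> V -> R[i])
    (A : seq V) (t : R[i]) (f g : V -> R[i]) :
  gram kappa A (fun x => f x + t * g x) (fun x => f x + t * g x) =
  gram kappa A f f + t * gram kappa A f g + t^* * gram kappa A g f
    + t^* * t * gram kappa A g g.
Proof.
rewrite /gram !mulr_sumr -!big_split /=; apply: eq_bigr => x _.
rewrite !mulr_sumr -!big_split /=; apply: eq_bigr => y _.
rewrite rmorphD rmorphM /=; ring.
Qed.

Lemma gram_ge0 (R : realType) (V : choiceType) (kappa : V -> V -> R[i])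
    (A : {fset V}) (f : V -> R[i]) :
  positive_definite kappa -> 0 <= gram kappa A f f.
Proof.
move=> pd; have := pd A (fun x => f (val x)).
congr (0 <= _); rewrite /gram big_seq_fsetE /=; apply: eq_bigr => x _.
by rewrite big_seq_fsetE /=; apply: eq_bigr => y _; ring.
Qed.

(** Hermitian symmetry follows from positivity alone: the forms at f + g and
    f + i g have zero imaginary part. *)
Lemma gramC (R : realType) (V : choiceType) (kappa : V -> V -> R[i])
    (A : {fset V}) (f g : V -> R[i]) :
  positive_definite kappa -> gram kappa A g f = ((gram kappa A f g)^*)%R.
Proof.
move=> pd.
have := gram_ge0 A (fun x => f x + 1 * g x) pd.
have := gram_ge0 A (fun x => f x + 'i * g x) pd.
have := gram_ge0 A f pd; have := gram_ge0 A g pd.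
rewrite !gramDZ.
case: (gram kappa A f f) => a1 a2; case: (gram kappa A g g) => b1 b2.
case: (gram kappa A f g) => s1 s2; case: (gram kappa A g f) => t1 t2.
rewrite !lecE /=; simpc => /=.
move=> /andP[/eqP-> _] /andP[/eqP-> _] /andP[/eqP i1 _] /andP[/eqP i2 _].
congr (_ +i* _); lra.
Qed.

(** The form may be degenerate, so <g, g> = 0 is a case of its own. *)
Lemma gram_CauchySchwarz (R : realType) (V : choiceType)
    (kappa : V -> V -> R[i]) (A : {fset V}) (f g : V -> R[i]) :
  positive_definite kappa ->
  `|gram kappa A f g| ^+ 2 <= gram kappa A f f * gram kappa A g g.
Proof.
move=> pd; set G := `|_| ^+ 2.
have GE : G = gram kappa A f g * (gram kappa A f g)^* by rewrite /G normCK.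
have G0 : 0 <= G by rewrite /G exprn_ge0.
set a := gram kappa A f f; set b := gram kappa A g g.
have a0 : 0 <= a by exact: gram_ge0.
have b0 : 0 <= b by exact: gram_ge0.
(* the form at f + t <g, f> g, for real t *)
have quad (t : R[i]) : (t^*)%R = t -> 0 <= a + 2 * t * G + t ^+ 2 * G * b.
  move=> tr.
  have := gram_ge0 A (fun x => f x + (t * (gram kappa A f g)^*) * g x) pd.
  rewrite gramDZ (gramC A f g pd) rmorphM /= conjCK tr GE -/a -/b.
  congr (0 <= _); ring.
move: b0; rewrite le_eqVlt => /predU1P[b0|b0].
  rewrite -b0 mulr0; move: G0; rewrite le_eqVlt => /predU1P[<-//|G0].
  (* with <g, g> = 0 the polynomial is affine in t; this t gives it value -1 *)
  have := quad (- ((a + 1) / (2 * G))).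
  rewrite -b0 mulr0 addr0 rmorphN /= ge0_conj; last first.
    by rewrite divr_ge0 ?addr_ge0 ?mulr_ge0 // ltW.
  move=> /(_ erefl).
  have -> : a + 2 * - ((a + 1) / (2 * G)) * G = -1 by field; rewrite gt_eqF.
  by rewrite oppr_ge0 ler10.
have := quad (- b^-1); rewrite rmorphN /= ge0_conj; last by rewrite invr_ge0 ltW.
move=> /(_ erefl).
have -> : a + 2 * - b^-1 * G + (- b^-1) ^+ 2 * G * b = a - G / b.
  by field; rewrite gt_eqF.
by rewrite subr_ge0 ler_pdivrMr.
Qed.

(** * Finitely supported combinations *)

Lemma gram_incl (R : realType) (V : choiceType) (kappa : V -> V -> R[i])
    (A B D : {fset V}) (f g : V -> R[i]) :
  (A `<=` D)%fset -> (B `<=` D)%fset ->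
  (forall x, x \notin A -> f x = 0) -> (forall y, y \notin B -> g y = 0) ->
  \sum_(x <- A) \sum_(y <- B) (f x)^* * g y * kappa x y = gram kappa D f g.
Proof.
move=> AD BD f0 g0; rewrite /gram -(big_fset_incl _ AD); last first.
  by move=> x _ /f0 ->; rewrite big1 // => y _; rewrite conjC0 !mul0r.
apply: eq_bigr => x _; apply: big_fset_incl => // y _ /g0 ->.
by rewrite mulr0 mul0r.
Qed.

Lemma kdotE (R : realType) (V : choiceType) (kappa : V -> V -> R[i])
    (D : {fset V}) (c d : {fsfun V -> R[i] with 0}) :
  (finsupp c `<=` D)%fset -> (finsupp d `<=` D)%fset ->
  kdot kappa c d = gram kappa D c d.
Proof. by move=> cD dD; apply: gram_incl => // x /fsfun_dflt. Qed.

Lemma fsfun_subE (R : realType) (V : choiceType)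
    (c d : {fsfun V -> R[i] with 0}) x : fsfun_sub c d x = c x - d x.
Proof.
rewrite /fsfun_sub fsfunE in_fsetU; case: ifPn => //.
by rewrite negb_or => /andP[/fsfun_dflt -> /fsfun_dflt ->]; rewrite subr0.
Qed.

Lemma kdot_fsfun_subE (R : realType) (V : choiceType) (kappa : V -> V -> R[i])
    (D : {fset V}) (c d : {fsfun V -> R[i] with 0}) :
  (finsupp c `<=` D)%fset -> (finsupp d `<=` D)%fset ->
  kdot kappa (fsfun_sub c d) (fsfun_sub c d) =
  gram kappa D (fun x => c x - d x) (fun x => c x - d x).
Proof.
move=> cD dD; have sD : (finsupp (fsfun_sub c d) `<=` D)%fset.
  apply/fsubsetP => x; rewrite mem_finsupp fsfun_subE.
  apply: contraNT => xD; rewrite !fsfun_dflt ?subr0 //.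
    by apply: contra xD; apply/fsubsetP.
  by apply: contra xD; apply/fsubsetP.
by rewrite (kdotE kappa sD sD); apply: eq_gram => x _; rewrite fsfun_subE.
Qed.

Lemma kdot_fsfun_subC (R : realType) (V : choiceType) (kappa : V -> V -> R[i])
    (c d : {fsfun V -> R[i] with 0}) :
  kdot kappa (fsfun_sub c d) (fsfun_sub c d) =
  kdot kappa (fsfun_sub d c) (fsfun_sub d c).
Proof.
pose D := (finsupp c `|` finsupp d)%fset.
have cD : (finsupp c `<=` D)%fset by exact: fsubsetUl.
have dD : (finsupp d `<=` D)%fset by exact: fsubsetUr.
rewrite (kdot_fsfun_subE kappa cD dD) (kdot_fsfun_subE kappa dD cD).
apply: eq_bigr => x _; apply: eq_bigr => y _; rewrite !rmorphB /=; ring.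
Qed.

(** The parallelogram law for c - d and d, with the nonnegative term
    ||c - 2 d||^2 dropped. *)
Lemma kdot_parallelogram (R : realType) (V : choiceType)
    (kappa : V -> V -> R[i]) (c d : {fsfun V -> R[i] with 0}) :
  positive_definite kappa ->
  kdot kappa c c <= 2 * kdot kappa (fsfun_sub c d) (fsfun_sub c d)
                    + 2 * kdot kappa d d.
Proof.
move=> pd; pose D := (finsupp c `|` finsupp d)%fset.
have cD : (finsupp c `<=` D)%fset by exact: fsubsetUl.
have dD : (finsupp d `<=` D)%fset by exact: fsubsetUr.
rewrite (kdot_fsfun_subE kappa cD dD) (kdotE kappa cD cD) (kdotE kappa dD dD).
set e := fun x => c x - d x.
have -> : gram kappa D c c =
    gram kappa D (fun x => e x + 1 * d x) (fun x => e x + 1 * d x).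
  by apply: eq_gram => x _; rewrite /e; ring.
have := gram_ge0 D (fun x => e x + (-1) * d x) pd.
rewrite !gramDZ rmorphN /= conjC1 => sub_ge0.
by rewrite -subr_ge0; move: sub_ge0; congr (0 <= _); ring.
Qed.

(** * Boundedness of the pairing with an element of H(k) *)

(** The left-hand side is |<sum_{x in F} xi(x) k_x, f>|^2, written with the
    values of f. *)
Lemma rkhs_pairing_bound (R : realType) (V : choiceType)
    (kappa : V -> V -> R[i]) (f : V -> R[i]) :
  positive_definite kappa -> rkhs kappa f ->
  exists C : R, forall (F : {fset V}) (xi : V -> R[i]),
    `|\sum_(x <- F) (xi x)^* * f x| ^+ 2 <= C%:C * gram kappa F xi xi.
Proof.
move=> pd [u cu fu].
have [N uN] : exists N, forall n, (N <= n)%N ->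
    knorm kappa (fsfun_sub (u n) (u N)) < 1.
  have [[P Q] /= [[n1 _ P1] [n2 _ Q2]] PQ] := cu 1 ltr01.
  exists (maxn n1 n2) => n; rewrite geq_max => /andP[n1n _].
  apply: (PQ (n, maxn n1 n2)); split; first exact: P1.
  by apply: Q2 => /=; rewrite leq_maxr.
have kdot_ge0 c : 0 <= kdot kappa c c.
  by rewrite (@kdotE _ _ _ (finsupp c)) ?gram_ge0.
have kdotR c : kdot kappa c c = (complex.Re (kdot kappa c c))%:C.
  have := kdot_ge0 c; case: (kdot _ _ _) => p q.
  by rewrite lecE /= => /andP[/eqP -> _].
(* ||u_n||^2 <= 2 ||u_n - u_N||^2 + 2 ||u_N||^2, and ||u_n - u_N|| < 1 *)
pose C := 2 + 2 * complex.Re (kdot kappa (u N) (u N)).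
have uC n : (N <= n)%N -> kdot kappa (u n) (u n) <= C%:C.
  move=> Nn; apply: le_trans (kdot_parallelogram _ (u N) pd) _.
  rewrite /C rmorphD rmorphM /= -kdotR rmorph_nat lerD2r.
  rewrite -[leRHS]mulr1 ler_pM2l ?ltr0n //.
  move: (uN _ Nn); rewrite /knorm -sqrtr1 ltr_sqrt // => /ltW.
  by rewrite [X in _ -> X <= _]kdotR -lecR.
exists C => F xi.
pose h n : R[i]^o := \sum_(x <- F) (xi x)^* * kcomb kappa (u n) x.
have hC n : (N <= n)%N -> `|h n| ^+ 2 <= C%:C * gram kappa F xi xi.
  move=> Nn; pose D := (F `|` finsupp (u n))%fset.
  have FD : (F `<=` D)%fset by exact: fsubsetUl.
  have uD : (finsupp (u n) `<=` D)%fset by exact: fsubsetUr.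
  pose xi0 x := if x \in F then xi x else 0.
  have xi00 x : x \notin F -> xi0 x = 0 by rewrite /xi0 => /negPf ->.
  have xi0E x : x \in F -> xi0 x = xi x by rewrite /xi0 => ->.
  have -> : gram kappa F xi xi = gram kappa D xi0 xi0.
    by rewrite -(gram_incl _ FD FD) //; apply: eq_gram => x /xi0E.
  have -> : h n = gram kappa D xi0 (u n).
    rewrite -(gram_incl _ FD uD) // => [|x /fsfun_dflt //].
    apply: eq_big_seq => x xF; rewrite mulr_sumr; apply: eq_bigr => y _.
    by rewrite xi0E // mulrA.
  apply: le_trans (gram_CauchySchwarz _ _ _ pd) _.
  rewrite mulrC; apply: ler_wpM2r; first exact: gram_ge0.
  by rewrite -(kdotE _ uD uD) uC.
set S := C%:C * _ in hC *.
have hcvg : (h n @[n --> \oo] --> (\sum_(x <- F) (xi x)^* * f x : R[i]^o)).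
  apply: cvg_big => [|x _]; first exact: add_continuous.
  by apply: cvgMr; exact: fu.
have S0 : 0 <= S by apply: le_trans (hC N (leqnn N)); rewrite exprn_ge0.
rewrite -[S]sqrtCK ler_pXn2r ?nnegrE ?sqrtC_ge0 //.
apply/ler_addgt0Pr => e e0.
have [M _ hM] := @cvgr_dist_lt R[i] R[i]^o _ _ _ h _ hcvg e e0.
have := hM (maxn M N) (leq_maxl _ _) => /= /ltW he.
have hS : `|h (maxn M N)| <= sqrtC S.
  by rewrite -(@ler_pXn2r _ 2) ?nnegrE ?sqrtC_ge0 // sqrtCK hC ?leq_maxr.
rewrite -(subrK (h (maxn M N)) (\sum_(x <- F) _)).
apply: le_trans (ler_normD _ _) _.
by rewrite addrC lerD.
Qed.

(** Extension by 0 to all of V of a function on a finite subset. *)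
Definition ext0 (T : nmodType) (V : choiceType) (F : {fset V}) (xi : F -> T)
    (x : V) : T :=
  if insub x is Some u then xi u else 0.

Lemma ext0_val (T : nmodType) (V : choiceType) (F : {fset V}) (xi : F -> T)
    (u : F) : ext0 xi (val u) = xi u.
Proof. by rewrite /ext0 valK. Qed.

Lemma ext0_out (T : nmodType) (V : choiceType) (F : {fset V}) (xi : F -> T) x :
  x \notin F -> ext0 xi x = 0.
Proof. by move=> xF; rewrite /ext0 insubN. Qed.

Lemma gram_ext0 (R : realType) (V : choiceType) (kappa : V -> V -> R[i])
    (F : {fset V}) (xi : F -> R[i]) :
  gram kappa F (ext0 xi) (ext0 xi) =
  \sum_(x : F) \sum_(y : F) (xi x)^* * xi y * kappa (val x) (val y).
Proof.
rewrite /gram big_seq_fsetE /=; apply: eq_bigr => x _.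
by rewrite big_seq_fsetE /=; apply: eq_bigr => y _; rewrite !ext0_val.
Qed.

Lemma kmat_ext0 (R : realType) (V : choiceType) (k : V -> V -> R)
    (F : {fset V}) (phi : F -> R) (x : F) :
  kmat k phi x = \sum_(y <- F) k (val x) y * ext0 phi y.
Proof.
by rewrite /kmat big_seq_fsetE /=; apply: eq_bigr => y _; rewrite ext0_val.
Qed.

Lemma rkhs_delta_bound (R : realType) (V : choiceType)
    (kappa : V -> V -> R[i]) (x1 : V) :
  positive_definite kappa -> rkhs kappa (delta R x1) ->
  exists C : R, forall (F : {fset V}) (x1F : x1 \in F) (xi : F -> R[i]),
    `|xi [` x1F]%fset| ^+ 2 <=
      C%:C * \sum_(x : F) \sum_(y : F)
               (xi x)^* * xi y * kappa (val x) (val y).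
Proof.
move=> pd H; have [C HC] := rkhs_pairing_bound pd H; exists C => F x1F xi.
have := HC F (ext0 xi); rewrite gram_ext0; congr (_ ^+ 2 <= _).
rewrite (big_fsetD1 x1) //= /delta eqxx mulr1 big_seq big1 ?addr0 => [|x].
  by rewrite norm_conjC; congr `|_|; exact: (ext0_val xi [` x1F]%fset).
by rewrite !inE => /andP[/negPf -> _]; rewrite mulr0.
Qed.

(** * Solvability of the linear system *)

(** Fredholm alternative for a square system with right-hand side the indicator
    of [i1]: it is solvable if the kernel of the transpose vanishes at [i1]. *)
Lemma ex_solution_col (K : fieldType) (I : finType) (a : I -> I -> K) (i1 : I) :
  (forall w : I -> K, (forall j, \sum_i a i j * w i = 0) -> w i1 = 0) ->
  exists z : I -> K, forall i, \sum_j a i j * z j = (i == i1)%:R.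
Proof.
move=> ker0.
(* row vectors act on the left, hence the transpose *)
pose A := (\matrix_(i < #|I|, j < #|I|) a (enum_val i) (enum_val j))^T.
have AE (w : 'I_#|I| -> K) (i : I) : \sum_j w j * A j (enum_rank i) =
    \sum_j a i j * w (enum_rank j).
  rewrite (reindex enum_rank) /=; last by apply: onW_bij; exact: enum_rank_bij.
  by apply: eq_bigr => j _; rewrite !mxE !enum_rankK mulrC.
have /submxP[z zA] : (delta_mx (0 : 'I_1) (enum_rank i1) <= A)%MS.
  rewrite submxE -rowE; move: (cokermx A) (mulmx_coker A) => B AB.
  apply/eqP/rowP => c; rewrite !mxE.
  apply: (ker0 (fun i => B (enum_rank i) c)) => j.
  have /matrixP/(_ (enum_rank j) c) := AB; rewrite !mxE; apply: etrans.
  rewrite [RHS](reindex enum_rank) /=; last first.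
    by apply: onW_bij; exact: enum_rank_bij.
  by apply: eq_bigr => i _; rewrite !mxE !enum_rankK.
exists (fun j => z 0 (enum_rank j)) => i; rewrite -AE.
have /matrixP/(_ 0 (enum_rank i)) := zA; rewrite !mxE eqxx /= => <-.
by rewrite (inj_eq enum_rank_inj).
Qed.

(** The complex inequality at a real function is a real inequality. *)
Lemma real_quadratic_bound (R : realType) (V : choiceType) (k : V -> V -> R)
    (x1 : V) (C : R) (F : {fset V}) (x1F : x1 \in F) (w : F -> R) :
  (forall xi : F -> R[i],
    `|xi [` x1F]%fset| ^+ 2 <=
      C%:C * \sum_(x : F) \sum_(y : F)
               (xi x)^* * xi y * (k (val x) (val y))%:C) ->
  w [` x1F]%fset ^+ 2 <=
    C * \sum_(x : F) \sum_(y : F) w x * w y * k (val x) (val y).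
Proof.
move=> /(_ (fun x => (w x)%:C)).
rewrite normc_def /= expr0n addr0 sqrtr_sqr.
have -> : \sum_x \sum_y ((w x)%:C)^* * (w y)%:C * (k (val x) (val y))%:C =
    (\sum_(x : F) \sum_(y : F) w x * w y * k (val x) (val y))%:C.
  rewrite rmorph_sum /=; apply: eq_bigr => x _.
  rewrite rmorph_sum /=; apply: eq_bigr => y _.
  by rewrite !rmorphM /=; congr (_ * _ * _); exact: conjc_real.
by rewrite -rmorphM -rmorphXn /= lecR -normrX ger0_norm ?sqr_ge0.
Qed.

Lemma kmat_solution_of_bound (R : realType) (V : choiceType) (k : V -> V -> R)
    (x1 : V) :
  (exists C : R, forall (F : {fset V}) (x1F : x1 \in F) (xi : F -> R[i]),
     `|xi [` x1F]%fset| ^+ 2 <=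
       C%:C * \sum_(x : F) \sum_(y : F)
                (xi x)^* * xi y * (k (val x) (val y))%:C) ->
  (forall F : {fset V}, x1 \in F ->
     exists zeta : F -> R, kmat_solution k x1 zeta) /\
  (ereal_sup [set t : \bar R |
     exists (F : {fset V}) (x1F : x1 \in F) (zeta : F -> R),
       kmat_solution k x1 zeta /\ t = (zeta [` x1F]%fset)%:E] < +oo)%E.
Proof.
move=> [C HC]; split=> [F x1F|].
  (* if w is in the kernel of the transpose, the quadratic form vanishes at w *)
  have [|z hz] := @ex_solution_col R F (fun x y => k (val x) (val y)) [` x1F]%fset.
    move=> w w0; apply/eqP; rewrite -sqrf_eq0 eq_le sqr_ge0 andbT.
    apply: le_trans (real_quadratic_bound w (HC F x1F)) _.
    rewrite exchange_big /= big1 ?mulr0 // => y _.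
    transitivity (w y * \sum_(x : F) k (val x) (val y) * w x).
      by rewrite mulr_sumr; apply: eq_bigr => x _; ring.
    by rewrite w0 mulr0.
  exists z => x; rewrite /kmat hz -val_eqE /=.
  by case: ifP.
(* C is not assumed nonnegative, hence the maximum with 0 *)
apply: (@le_lt_trans _ _ (Num.max C 0)%:E); last exact: ltry.
apply: ge_ereal_sup => _ [F [x1F [z [hz ->]]]]; rewrite lee_fin.
have := real_quadratic_bound z (HC F x1F).
have -> : \sum_(x : F) \sum_(y : F) z x * z y * k (val x) (val y)
    = z [` x1F]%fset.
  transitivity (\sum_(x : F) z x * kmat k z x).
    apply: eq_bigr => x _; rewrite mulr_sumr; apply: eq_bigr => y _; ring.
  rewrite (bigD1 [` x1F]%fset) //= hz eqxx mulr1 big1 ?addr0 // => x.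
  by rewrite hz -val_eqE /= => /negPf ->; rewrite mulr0.
rewrite le_max; have [z0|z0] := leP (z [` x1F]%fset) 0; first by rewrite orbT.
by rewrite expr2 ler_pM2r // => ->.
Qed.

(** * Approximating the indicator along an exhaustion *)

(** Here z n plays the role of K_{F n}^-1 delta_{x1}, extended by 0. *)
Lemma rkhs_delta_of_solutions (R : realType) (V : choiceType) (k : V -> V -> R)
    (x1 : V) (F : nat -> {fset V}) (z : nat -> V -> R) (M : R) :
  positive_definite (fun x y => (k x y)%:C) ->
  {homo F : m n / (m <= n)%N >-> (m `<=` n)%fset} ->
  (forall x, exists n, x \in F n) -> (forall n, x1 \in F n) ->
  (forall n x, x \notin F n -> z n x = 0) ->
  (forall n x, x \in F n ->
     \sum_(y <- F n) k x y * z n y = if x == x1 then 1 else 0) ->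
  (forall n, z n x1 <= M) ->
  rkhs (fun x y => (k x y)%:C) (delta R x1).
Proof.
move=> pd Fmono Fcov x1F z0 hz zM; set kappa := fun x y => _ in pd *.
pose u n : {fsfun V -> R[i] with 0} := [fsfun x in F n => (z n x)%:C].
have uE n x : u n x = (z n x)%:C.
  by rewrite fsfunE; case: ifPn => // /z0 ->.
have u0 n x : x \notin F n -> u n x = 0 by move=> xF; rewrite uE z0.
have uF n : (finsupp (u n) `<=` F n)%fset.
  by apply/fsubsetP => x; rewrite mem_finsupp; apply: contraNT => /u0 ->.
have uFm m n : (m <= n)%N -> (finsupp (u m) `<=` F n)%fset.
  by move=> mn; apply: fsubset_trans (uF m) (Fmono _ _ mn).
have sumE n x : x \in F n -> \sum_(y <- F n) u n y * kappa x y = delta R x1 x.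
  move=> /hz kz; transitivity ((\sum_(y <- F n) k x y * z n y)%:C).
    rewrite rmorph_sum /=; apply: eq_bigr => y _.
    by rewrite uE /kappa -rmorphM mulrC.
  by rewrite kz /delta; case: ifP.
have kcombE n x : x \in F n -> kcomb kappa (u n) x = delta R x1 x.
  move=> /sumE <-; apply: big_fset_incl => // y _ /fsfun_dflt ->.
  by rewrite mul0r.
(* the combination u n represents evaluation at x1 on functions on F n *)
have repro n f : gram kappa (F n) f (u n) = ((f x1)^*)%R.
  transitivity (\sum_(x <- F n) ((f x)^*)%R * delta R x1 x).
    apply: eq_big_seq => x /sumE <-; rewrite mulr_sumr.
    by apply: eq_bigr => y _; rewrite mulrA.
  rewrite (big_fsetD1 x1) //= /delta eqxx mulr1 big_seq big1 ?addr0 // => x.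
  by rewrite !inE => /andP[/negPf -> _]; rewrite mulr0.
have conjz n : ((u n x1)^*)%R = (z n x1)%:C by rewrite uE; exact: conjc_real.
have distE m n : (m <= n)%N ->
    kdot kappa (fsfun_sub (u m) (u n)) (fsfun_sub (u m) (u n)) =
    (z n x1 - z m x1)%:C.
  move=> mn; rewrite (kdot_fsfun_subE kappa (uFm _ _ mn) (uF n)).
  have -> : gram kappa (F n) (fun x => u m x - u n x) (fun x => u m x - u n x) =
     gram kappa (F n) (fun x => u m x + (-1) * u n x)
                      (fun x => u m x + (-1) * u n x).
    by apply: eq_gram => x _; ring.
  rewrite gramDZ rmorphN /= conjC1 (gramC _ (u m) (u n) pd) !repro conjCK.
  rewrite -(gram_incl kappa (Fmono _ _ mn) (Fmono _ _ mn) (u0 m) (u0 m)).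
  have := repro m (u m); rewrite /gram => ->.
  by rewrite !conjz uE rmorphB /=; ring.
have zmono : {homo (fun n => z n x1) : m n / (m <= n)%N >-> m <= n}.
  move=> m n mn; rewrite -subr_ge0 -lecR -distE //.
  by rewrite (kdot_fsfun_subE kappa (uFm _ _ mn) (uF n)) gram_ge0.
exists u; last first.
  move=> x; apply: (@cvg_near_cst nat R[i]^o).
  have [n xn] := Fcov x; exists n => // m /= nm; apply: kcombE.
  exact: (fsubsetP (Fmono _ _ nm)).
have knormE m n :
    knorm kappa (fsfun_sub (u m) (u n)) = Num.sqrt `|z m x1 - z n x1|.
  rewrite /knorm; have [mn|/ltnW mn] := leqP m n.
    by rewrite distE // distrC ger0_norm // subr_ge0 zmono.
  by rewrite kdot_fsfun_subC distE // ger0_norm // subr_ge0 zmono.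
have zcvg : cvgn (fun n => z n x1).
  by apply: nondecreasing_is_cvgn => //; exists M => _ [n _ <-].
move=> e e0; have e2 : 0 < e ^+ 2 / 2 by rewrite divr_gt0 ?exprn_gt0.
have /cvgrPdist_lt/(_ _ e2) zl := zcvg.
near=> m n => /=; rewrite knormE -[e]ger0_norm ?(ltW e0) //.
rewrite -(sqrtr_sqr e) ltr_sqrt ?exprn_gt0 //.
rewrite (splitr (e ^+ 2)) -(subrK (limn (fun n => z n x1)) (z m x1)) -addrA.
apply: le_lt_trans (ler_normD _ _) _; apply: ltrD; last by near: n.
by rewrite distrC; near: m.
Unshelve. all: by end_near. Qed.

(** An enumeration of V yields an increasing sequence of finite sets that
    contain a given point and cover V. *)
Lemma exists_fset_exhaustion (V : choiceType) (x1 : V) :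
  countable [set: V] ->
  exists F : nat -> {fset V},
    [/\ {homo F : m n / (m <= n)%N >-> (m `<=` n)%fset},
        forall x, exists n, x \in F n & forall n, x1 \in F n].
Proof.
move=> /countable_injP[h hinj].
(* g is a left inverse of the injection h; off the range of h it takes the
   default value x1 *)
have /choice[g gh] : forall n, exists x, forall y, h y = n -> x = y.
  move=> n; have [[y hy]|no] := pselect (exists y, h y = n).
    by exists y => y' hy'; apply: hinj; rewrite ?inE // hy hy'.
  by exists x1 => y hy; case: no; exists y.
exists (fun n => seq_fset tt (x1 :: [seq g i | i <- iota 0 n])); split.
- move=> m n mn; apply/fsubsetP => x; rewrite !seq_fsetE !inE.
  move=> /orP[->//|xm]; have [i + ->] := elimT seq.mapP xm.
  rewrite mem_iota add0n => im.
  by rewrite map_f ?orbT // mem_iota add0n (leq_trans im).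
- move=> x; exists (h x).+1; rewrite seq_fsetE inE; apply/orP; right.
  by rewrite -[X in X \in _](gh (h x) x erefl) map_f // mem_iota /=.
- by move=> n; rewrite seq_fsetE inE eqxx.
Qed.

Lemma rkhs_delta_of_kmat_solution (R : realType) (V : choiceType)
    (k : V -> V -> R) (x1 : V) :
  countable [set: V] -> positive_definite (fun x y => (k x y)%:C) ->
  (forall F : {fset V}, x1 \in F ->
     exists zeta : F -> R, kmat_solution k x1 zeta) ->
  (ereal_sup [set t : \bar R |
     exists (F : {fset V}) (x1F : x1 \in F) (zeta : F -> R),
       kmat_solution k x1 zeta /\ t = (zeta [` x1F]%fset)%:E] < +oo)%E ->
  rkhs (fun x y => (k x y)%:C) (delta R x1).
Proof.
move=> cV pd sol supfin; set S := [set t | _] in supfin.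
have [F [Fmono Fcov x1F]] := exists_fset_exhaustion x1 cV.
have /choice[z hz] : forall n, exists z : V -> R,
  [/\ forall x, x \notin F n -> z x = 0,
    forall x, x \in F n ->
      \sum_(y <- F n) k x y * z y = if x == x1 then 1 else 0
    & S (z x1)%:E].
  move=> n; have [zeta hzeta] := sol _ (x1F n); exists (ext0 zeta); split.
  - by move=> x; exact: ext0_out.
  - by move=> x xF; rewrite -(hzeta [` xF]%fset) kmat_ext0.
  - exists (F n), (x1F n), zeta; split=> //.
    by rewrite -(ext0_val zeta [` x1F n]%fset).
apply: (@rkhs_delta_of_solutions _ _ _ _ F z (fine (ereal_sup S))) => // [n|n|n].
- by case: (hz n).
- by case: (hz n).
have [_ _ /ereal_sup_ubound zS] := hz n.
by move: supfin zS; case: (ereal_sup S).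
Qed.

(** * The equivalence *)

Theorem theorem2p12 (R : realType) (V : choiceType)
    (V_ctbl_inf : ([set: V] #= [set: nat])%card)
    (k : V -> V -> R)
    (k_pd : positive_definite (fun x y => (k x y)%:C))
    (x1 : V) :
  [<-> rkhs (fun x y => (k x y)%:C) (delta R x1);
       exists C : R, forall (F : {fset V}) (x1F : x1 \in F) (xi : F -> R[i]),
         `|xi [` x1F]%fset| ^+ 2 <=
           C%:C * \sum_(x : F) \sum_(y : F)
                    (xi x)^* * xi y * (k (val x) (val y))%:C;
       (forall F : {fset V}, x1 \in F ->
          exists zeta : F -> R, kmat_solution k x1 zeta) /\
       (ereal_sup [set t : \bar R |
          exists (F : {fset V}) (x1F : x1 \in F) (zeta : F -> R),
            kmat_solution k x1 zeta /\ t = (zeta [` x1F]%fset)%:E] < +oo)%E].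
Proof.
have cV : countable [set: V] by have /card_eqPle[] := V_ctbl_inf.
split; first exact: rkhs_delta_bound.
split; first exact: kmat_solution_of_bound.
by case=> sol supfin; exact: rkhs_delta_of_kmat_solution.
Qed.
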